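(* Let $0<\epsilon<1$. There is a deterministic insertion-deletion streaming algorithm that, for any $n$-vertex graph given as an insertion-deletion stream, outputs a vertex cover of the final graph of size at most $n^{\epsilon}$ times the size of a minimum vertex cover, and uses space $\mathrm{O}(n^{2-2\epsilon}\log n)$.
   Context: An insertion-deletion graph stream on a known vertex set $V$ with $|V|=n$ is a sequence of edge insertions and edge deletions, where each deletion removes a currently present edge; the input graph $G=(V,E)$ consists of the edges present at the end of the stream. Space is measured in bits of memory. *)

(* Defs.v *)
From mathcomp Require Import all_boot.

Set Implicit Arguments.
Unset Strict Implicit.
Unset Printing Implicit Defensive.

Section Graphs.
Variable V : finType.

                                                                            
                                     
Definition edge := {e : {set V} | #|e| == 2}.
Definition graph := {set edge}.

Definition vertex_cover (G : graph) (C : {set V}) : bool :=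
  [forall e in G, [exists x in C, x \in val e]].

Lemma vertex_coverT (G : graph) : vertex_cover G setT.
Proof.
apply/forall_inP => e _; have /cards2P[x [y [_ ->]]] := valP e.
by apply/exists_inP; exists x; rewrite !inE ?eqxx.
Qed.

                                                                              
Definition min_vertex_cover_size (G : graph) : nat :=
  #|[arg min_(C < [set: V] | vertex_cover G C) #|C| ]|.

Inductive update : Type := Insertion of edge | Deletion of edge.

Definition apply_update (G : graph) (u : update) : graph :=
  match u with
  | Insertion e => e |: G
  | Deletion e => G :\ e
  end.

                                                                           
                                
Definition admissible (G : graph) (u : update) : bool :=
  match u with
  | Insertion e => e \notin G
  | Deletion e => e \in G
  end.

Fixpoint stream_from (G : graph) (s : seq update) : bool :=
  if s is u :: s' then admissible G u && stream_from (apply_update G u) s'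
  else true.

Definition graph_stream (s : seq update) : bool := stream_from set0 s.

Definition final_graph (s : seq update) : graph := foldl apply_update set0 s.

End Graphs.

                                                                          
                                                                              
                                                                        
Record streaming_algorithm (item output : Type) (b : nat) := StreamingAlgorithm {
  initial_memory : b.-tuple bool;
  process : b.-tuple bool -> item -> b.-tuple bool;
  answer : b.-tuple bool -> output
}.

Definition run (item output : Type) (b : nat)
    (A : streaming_algorithm item output b) (s : seq item) : output :=
  answer A (foldl (process A) (initial_memory A) s).

(* Main.v *)
(** Split [V] into blocks of size [k <= n^eps] and keep, for every pair of
    blocks, the number of edges running between them; deletions simply decrease
    these counters.  At the end the counters determine the quotient graph (with
    loops) on the blocks, and the output is the union of the blocks of one of its
    minimum vertex covers.  The blocks met by an optimal cover of the input
    graph form a cover of the quotient, so at most [k] times the optimum is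
    output.  There are [O(n^(1-eps))] blocks and each counter takes
    [O(log n)] bits. *)
Require Import Defs.
From mathcomp Require Import all_boot all_order all_algebra.
From mathcomp Require Import all_classical all_reals all_analysis.
From mathcomp Require Import zify ring lra.
Import Order.TTheory GRing.Theory Num.Theory.
Import numFieldNormedType.Exports.

(** * Streaming algorithms from updatable summaries *)

Lemma leq_card_inj (S T : finType) :
  (#|S| <= #|T|)%N -> exists f : S -> T, injective f.
Proof.
move=> leST; exists (fun x => enum_val (widen_ord leST (enum_rank x))).
move=> x y /enum_val_inj /(congr1 val) /= /ord_inj; exact: enum_rank_inj.
Qed.

(** The memory holds an injective [b]-bit code of the summary [F G] of the current graph; this
    invariant survives every admissible update, and [ans] reads the decoded summary. *)
Lemma streaming_algorithm_of_sketch (V S : finType) (output : Type) (b : nat)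
    (F : graph V -> S) (up : S -> update V -> S) (ans : S -> output) :
  (#|S| <= 2 ^ b)%N ->
  (forall G u, admissible G u -> F (apply_update G u) = up (F G) u) ->
  exists A : streaming_algorithm (update V) output b,
    forall s, graph_stream s -> run A s = ans (F (final_graph s)).
Proof.
move=> leS Fup.
have /leq_card_inj[f injf] : (#|S| <= #|{: b.-tuple bool}|)%N.
  by rewrite card_tuple card_bool.
(* The default is met only on bit strings outside the image of [f], which no run reaches. *)
pose g t := odflt (F finset.set0) [pick x | f x == t].
have gK : cancel f g.
  move=> x; rewrite /g; case: pickP => [y /eqP/injf //|/(_ x)].
  by rewrite eqxx.
exists (StreamingAlgorithm (f (F finset.set0)) (fun t u => f (up (g t) u))
         (fun t => ans (g t))).
rewrite /graph_stream /final_graph /run /=.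
move=> s; elim: s finset.set0 => [|u s IHs] G /=; first by rewrite gK.
by move=> /andP[adm /IHs <-]; rewrite gK Fup.
Qed.

(** * Edge counters between blocks and covers of the quotient *)

Section QuotientSketch.
Variables (V W : finType) (h : V -> W).

Local Notation counts := {ffun W * W -> 'I_#|{: edge V}|.+1}.

(* The diagonal pair [(w, w)] collects the edges inside the block [w]; the
   pairs [(w, w')] and [(w', w)] carry the same edges. *)
Definition block_edges (G : graph V) (p : W * W) : graph V :=
  [set e in G | h @: val e == [set p.1; p.2]%SET]%SET.

Definition block_counts (G : graph V) : counts :=
  [ffun p => inord #|block_edges G p|].

Definition update_counts (c : counts) (u : update V) : counts :=
  match u with
  | Insertion e => [ffun p =>
      inord (c p + (h @: val e == [set p.1; p.2]%SET))]
  | Deletion e => [ffun p =>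
      inord (c p - (h @: val e == [set p.1; p.2]%SET))]
  end.

(** These are the vertex covers of the quotient graph; a loop at [w], that is a nonzero counter at
    [(w, w)], forces [w] into [D]. *)
Definition counts_cover (c : counts) (D : {set W}) :=
  [forall p, (c p != 0 :> nat) ==> (p.1 \in D) || (p.2 \in D)].

Definition cover_of_counts (c : counts) : {set V} :=
  h @^-1: [arg min_(D < [set: W]%SET | counts_cover c D) #|D|].

Lemma block_countsE (G : graph V) (p : W * W) :
  block_counts G p = #|block_edges G p| :> nat.
Proof. by rewrite ffunE inordK // ltnS max_card. Qed.

Lemma block_edges_setU1 (e : edge V) (G : graph V) (p : W * W) :
  block_edges (e |: G) p =
  if h @: val e == [set p.1; p.2]%SET then e |: block_edges G p
  else block_edges G p.
Proof.
have [he|he] := ifPn; apply/setP => x; rewrite !inE; case: eqP => //= ->.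
  by rewrite he.
by rewrite (negbTE he) andbF.
Qed.

Lemma block_edges_setD1 (e : edge V) (G : graph V) (p : W * W) :
  block_edges (G :\ e) p = block_edges G p :\ e.
Proof. by apply/setP => x; rewrite !inE andbA. Qed.

(** Admissibility makes an inserted edge new and a deleted edge present, so the matching counters
    change by exactly one. *)
Lemma block_counts_update (G : graph V) (u : update V) : admissible G u ->
  block_counts (apply_update G u) = update_counts (block_counts G) u.
Proof.
case: u => e /= eG; apply/ffunP => p; rewrite [LHS]ffunE [RHS]ffunE;
  rewrite block_countsE; congr inord.
  rewrite block_edges_setU1; case: ifP => _; last by rewrite addn0.
  by rewrite cardsU1 inE (negbTE eG) addnC.
by rewrite block_edges_setD1 (cardsD1 e (block_edges G p)) inE eG /= addKn.
Qed.

Lemma counts_coverT (c : counts) :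
  counts_cover c [set: W]%SET.
Proof. by apply/forallP => p; rewrite inE implybT. Qed.

Lemma vertex_cover_preim (G : graph V) (D : {set W}) :
  counts_cover (block_counts G) D -> vertex_cover G (h @^-1: D).
Proof.
move=> /forallP covD; apply/forall_inP => e eG.
have /cards2P[x [y [_ exy]]] := valP e.
have := covD (h x, h y); rewrite block_countsE -lt0n.
have -> : (0 < #|block_edges G (h x, h y)|)%N.
  by apply/card_gt0P; exists e; rewrite inE eG exy imsetU1 imset_set1 eqxx.
rewrite /= => /orP[hD|hD]; apply/exists_inP.
  by exists x; rewrite ?exy !inE ?eqxx.
by exists y; rewrite ?exy !inE ?eqxx ?orbT.
Qed.

Lemma counts_cover_imset (G : graph V) (C : {set V}) :
  vertex_cover G C -> counts_cover (block_counts G) (h @: C).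
Proof.
move=> /forall_inP covC; apply/forallP => p; apply/implyP.
rewrite block_countsE -lt0n => /card_gt0P[e]; rewrite inE => /andP[eG /eqP he].
have /exists_inP[x xC xe] := covC e eG.
have : h x \in [set p.1; p.2]%SET by rewrite -he imset_f.
by rewrite !inE => /orP[]/eqP <-; rewrite (imset_f h xC) ?orbT.
Qed.

Lemma cover_of_countsP (G : graph V) :
  vertex_cover G (cover_of_counts (block_counts G)).
Proof.
apply: vertex_cover_preim; rewrite /cover_of_counts.
by case: arg_minnP => //; exact: counts_coverT.
Qed.

Lemma leq_card_preimset (k : nat) (D : {set W}) :
  (forall w, #|h @^-1: [set w]%SET| <= k) -> #|h @^-1: D| <= #|D| * k.
Proof.
move=> hk; rewrite -sum1_card (partition_big h (mem D)) /=; last first.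
  by move=> x; rewrite inE.
rewrite -sum_nat_const; apply: leq_sum => w _.
apply: leq_trans (hk w); rewrite -[leqRHS]sum1_card.
rewrite [leqLHS]big_mkcond [leqRHS]big_mkcond; apply: leq_sum => x _.
by rewrite !inE; case: (h x == w); rewrite ?andbF // andbT; case: ifP.
Qed.

(** For a minimum cover [C] of [G] and a minimum cover [D] of the quotient, the output has at most
    [k * #|D|] vertices, and [#|D| <= #|h @: C| <= #|C|] because [h @: C] covers the quotient. *)
Lemma leq_card_cover_of_counts (k : nat) (G : graph V) :
  (forall w, #|h @^-1: [set w]%SET| <= k) ->
  #|cover_of_counts (block_counts G)| <= k * min_vertex_cover_size G.
Proof.
move=> hk; rewrite /cover_of_counts /min_vertex_cover_size.
case: arg_minnP => [|D _ minD]; first exact: counts_coverT.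
case: arg_minnP => [|C covC _]; first exact: vertex_coverT.
apply: leq_trans (leq_card_preimset _ _ hk) _.
rewrite mulnC leq_mul2l; apply/orP; right.
exact: leq_trans (minD _ (counts_cover_imset _ _ covC)) (leq_imset_card _ _).
Qed.

End QuotientSketch.

(** * Bit cost of the counters and the partition into blocks *)

Lemma card_edge_lt (V : finType) : #|{: edge V}| < 2 ^ (up_log 2 #|V|).*2.
Proof.
rewrite card_sig -[#|_|](cardsE [pred A : {set V} | #|A| == 2]) card_draws bin2.
case: #|V| => [|m] //; rewrite -addnn expnD.
have le_m := up_logP m.+1 (isT : 1 < 2).
by apply: leq_trans (leq_mul le_m le_m); rewrite /=; nia.
Qed.

Lemma quotient_algorithm (V W : finType) (h : V -> W) (k : nat) :
  (forall w, #|h @^-1: [set w]%SET| <= k) ->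
  exists A : streaming_algorithm (update V) {set V}
               ((up_log 2 #|V|).*2 * #|W| ^ 2),
    forall s, graph_stream s ->
      vertex_cover (final_graph s) (run A s) /\
      #|run A s| <= k * min_vertex_cover_size (final_graph s).
Proof.
move=> hk.
have [|A runA] := streaming_algorithm_of_sketch V _ _
    ((up_log 2 #|V|).*2 * #|W| ^ 2) (block_counts V W h) (update_counts V W h)
    (cover_of_counts V W h) _ (block_counts_update V W h).
  rewrite card_ffun card_ord card_prod mulnn (expnM 2).
  (* A counter ranges from 0 to the number of possible edges, so the strict bound [card_edge_lt] is
     what makes it fit; exponent 0 is split off for [leq_exp2r]. *)
  by case: (#|W| ^ 2) => // m; rewrite leq_exp2r ?card_edge_lt.
exists A => s /runA ->; split; first exact: cover_of_countsP.
exact: leq_card_cover_of_counts.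
Qed.

(** Vertices of one block share the quotient by [k], so their remainders, of which there are [k],
    tell them apart. The conditional hypothesis allows [k = 0] when there are no vertices. *)
Lemma card_fiber_divn (n k : nat) (w : 'I_(n %/ k).+1) : (0 < n -> 0 < k) ->
  #|(fun v : 'I_n => inord (v %/ k) : 'I_(n %/ k).+1) @^-1: [set w]%SET| <= k.
Proof.
move=> k_gt0; rewrite -[leqRHS]card_ord.
set fiber := (_ @^-1: _)%SET; have [->|[v0 _]] := set_0Vmem fiber.
  by rewrite cards0.
have kP : 0 < k by apply: k_gt0; apply: leq_ltn_trans (ltn_ord v0).
rewrite -(card_in_imset (f := fun v : 'I_n => Ordinal (ltn_pmod v kP))) ?max_card //.
move=> x y; rewrite !inE => /eqP <- /eqP /(congr1 val) /=.
rewrite !inordK ?ltnS ?leq_div2r ?(ltnW (ltn_ord _)) // => dxy /(congr1 val) /= mxy.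
by apply/val_inj; rewrite /= (divn_eq x k) (divn_eq y k) dxy mxy.
Qed.

(** * Asymptotic bound on the space *)

Section Space.
Variables (R : realType) (eps : R).
Local Open Scope ring_scope.
Hypotheses (eps_ge0 : 0 <= eps) (eps_le1 : eps <= 1).

Definition block_size (n : nat) : nat := Num.truncn (n%:R `^ eps).

Lemma block_size_le (n : nat) : (block_size n)%:R <= n%:R `^ eps.
Proof. by rewrite truncn_le powR_ge0. Qed.

Lemma powR_natr_ge1 (n : nat) (x : R) : (0 < n)%N -> 0 <= x -> 1 <= n%:R `^ x.
Proof.
move=> n_gt0 x_ge0; have n_ge1 : 1 <= n%:R :> R by rewrite ler1n.
by have := ler_powR n_ge1 x_ge0; rewrite powRr0.
Qed.

Lemma block_size_gt0 (n : nat) : (0 < n)%N -> (0 < block_size n)%N.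
Proof. by move=> n_gt0; rewrite truncn_gt_nat powR_natr_ge1. Qed.

(** With [k] the block size, rounding down gives [n^eps < k + 1 <= 2k], hence
    [n / k <= 2 n^(1-eps)]; the extra block costs at most one more [n^(1-eps)], which is at least
    1. *)
Lemma blocks_le (n : nat) : (0 < n)%N ->
  ((n %/ block_size n).+1)%:R <= 3 * n%:R `^ (1 - eps).
Proof.
move=> n_gt0; set k := block_size n; set q := (n %/ k)%N.
have k_ge1 : 1 <= k%:R :> R by rewrite ler1n block_size_gt0.
have r_ge1 : 1 <= n%:R `^ (1 - eps) by rewrite powR_natr_ge1 // subr_ge0.
have a_lt : n%:R `^ eps < k%:R + 1.
  by have /andP[_] := truncn_itv (powR_ge0 n%:R eps); rewrite natr1.
have ra : n%:R `^ (1 - eps) * n%:R `^ eps = n%:R.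
  by rewrite -powRD ?subrK ?powRr1 // pnatr_eq0 -lt0n n_gt0 implybT.
have qk : q%:R * k%:R <= n%:R :> R by rewrite -natrM ler_nat leq_divM.
have : q%:R <= 2 * n%:R `^ (1 - eps).
  rewrite -(ler_pM2r (lt_le_trans ltr01 k_ge1)) (le_trans qk) // -[leLHS]ra.
  by rewrite [2 * _]mulrC -mulrA ler_pM2l ?(lt_le_trans ltr01 r_ge1) //; lra.
by rewrite -natr1; lra.
Qed.

(** From [2 ^ (up_log 2 n).-1 < n] one gets the bound up to a rounding term [ln 2], which is
    absorbed by a second [ln n]. *)
Lemma up_log2_le (n : nat) : (1 < n)%N -> (up_log 2 n)%:R <= 2 / ln 2 * ln n%:R :> R.
Proof.
move=> n_gt1; have ln2 : 0 < ln 2 :> R by rewrite ln_gt0 // ltr1n.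
have ln_le : ln 2 <= ln n%:R :> R by rewrite ler_ln ?posrE ?ltr0n ?ler_nat // ltnW.
have := up_log_gtn (isT : (1 < 2)%N) n_gt1.
rewrite -(ltr_nat R) natrX -ltr_ln ?posrE ?exprn_gt0 ?ltr0n ?(ltnW n_gt1) //.
rewrite lnXn ?ltr0n // -[X in X < _]mulr_natl.
have -> : (up_log 2 n)%:R = (up_log 2 n).-1%:R + 1 :> R.
  by rewrite natr1 prednK // up_log_gt0.
move: (_.-1%:R) => u hu.
rewrite -mulrA [_^-1 * _]mulrC mulrA ler_pdivlMr //; lra.
Qed.

Definition sketch_space (n : nat) : nat :=
  (up_log 2 n).*2 * (n %/ block_size n).+1 ^ 2.

Lemma sketch_space_le (n : nat) : (1 < n)%N ->
  (sketch_space n)%:R <= 36 / ln 2 * (n%:R `^ (2 - 2 * eps) * ln n%:R).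
Proof.
move=> n_gt1; have := blocks_le _ (ltnW n_gt1); have := up_log2_le _ n_gt1.
have -> : n%:R `^ (2 - 2 * eps) = n%:R `^ (1 - eps) ^+ 2.
  by rewrite -powR_mulrn ?powR_ge0 // -powRrM; congr powR; ring.
rewrite /sketch_space natrM natrX -muln2 natrM => hu hm.
(* The constant is [36 = 2 * 2 * 3 ^ 2]: from [up_log2_le], the doubled counter length, and the
   squared number of blocks. *)
rewrite [leRHS](_ : _ =
  2 / ln 2 * ln n%:R * 2 * (3 * n%:R `^ (1 - eps)) ^+ 2); last by ring.
apply: ler_pM; rewrite ?mulr_ge0 ?exprn_ge0 ?ler0n ?ler_wpM2r //.
by rewrite lerXn2r ?nnegrE ?mulr_ge0 ?powR_ge0 ?ler0n.
Qed.

End Space.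

(** * The approximation algorithm *)

Local Open Scope classical_set_scope.
Local Open Scope ring_scope.

Theorem theorem11 (R : realType) (eps : R) (eps_gt0 : 0 < eps) (eps_lt1 : eps < 1) :
  exists (space : nat -> nat)
         (A : forall n : nat,
            streaming_algorithm (update 'I_n) {set 'I_n} (space n)),
    (forall (n : nat) (s : seq (update 'I_n)), graph_stream s ->
       vertex_cover (final_graph s) (run (A n) s) /\
       #|run (A n) s|%:R
         <= n%:R `^ eps * (min_vertex_cover_size (final_graph s))%:R) /\
    (fun n : nat => (space n)%:R : R^o) =O_\oo
      (fun n : nat => n%:R `^ (2 - 2 * eps) * ln n%:R : R^o).
Proof.
have eps_ge0 := ltW eps_gt0; have eps_le1 := ltW eps_lt1.
have algP n : exists A :
    streaming_algorithm (update 'I_n) {set 'I_n} (sketch_space R eps n),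
    forall s, graph_stream s ->
      vertex_cover (final_graph s) (run A s) /\
      (#|run A s| <= block_size R eps n * min_vertex_cover_size (final_graph s))%N.
  have := quotient_algorithm _ _ _ _ (fun w =>
    card_fiber_divn n (block_size R eps n) w (block_size_gt0 R eps eps_ge0 n)).
  by rewrite !card_ord.
(* Choice turns the existence statement for each [n] into a family of algorithms. *)
exists (sketch_space R eps), (fun n => projT1 (cid (algP n))); split.
  move=> n s /(projT2 (cid (algP n)))[cov size_le]; split => //.
  apply: (@le_trans _ _
    (block_size R eps n * min_vertex_cover_size (final_graph s))%:R).
    by rewrite ler_nat.
  by rewrite natrM ler_wpM2r ?ler0n ?block_size_le.
have ln2 : 0 < ln 2 :> R by rewrite ln_gt0 // ltr1n.
apply/eqO_exP; exists (36 / ln 2); first by rewrite divr_gt0.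
(* From [n = 2] on, [ln n] is large enough to absorb the rounding of the logarithm. *)
exists 2%N => // n /= n_gt1.
rewrite ger0_norm ?ler0n // ger0_norm; first exact: sketch_space_le.
by rewrite mulr_ge0 ?powR_ge0 // ln_ge0 // ler1n ltnW.
Qed.
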